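(* Let $a$ be an odd integer and $b$ an even integer with $a > b \geq 2$. Then the equation $3^{a}+3^{b}+2=n^5$ has no solution in positive integers $n$; that is, there is no triple $(a,b,n)$ of positive integers with $a$ odd, $b$ even, $a>b\geq 2$, and $3^{a}+3^{b}+2=n^5$.
   Context: ''Insoluble'' means there are no solutions in positive integers. All variables $a,b,n$ are positive integers. *)

(* Defs.v *)
From mathcomp Require Export all_boot.

Set Implicit Arguments.
Unset Strict Implicit.
Unset Printing Implicit Defensive.

(* Main.v *)
Require Import Defs.
From mathcomp Require Import all_boot.

(** The obstruction is 2-adic.  Since 3 is -1 modulo 4, exponents of opposite
    parity make [3 ^ a + 3 ^ b] vanish modulo 4, so the left-hand side is 2
    modulo 4: divisible by 2 exactly once, unlike any fifth power. *)

Lemma modn_exp3_4 k : 3 ^ k %% 4 = if odd k then 3 else 1.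
Proof.
elim: k => [//|k IHk].
by rewrite expnS -modnMmr IHk /=; case: (odd k).
Qed.

Lemma modn_exp5_4_neq2 n : n ^ 5 %% 4 != 2.
Proof.
by rewrite -modnXm; have := ltn_pmod n (isT : 0 < 4); case: (n %% 4) => [|[|[|[]]]].
Qed.

Theorem corollary1 (a b : nat) (ha : odd a) (hb : ~~ odd b) (hab : b < a) (hb2 : 2 <= b) :
  ~ (exists n : nat, 0 < n /\ 3 ^ a + 3 ^ b + 2 = n ^ 5).
Proof.
move=> [n [_ eq_n]]; have := modn_exp5_4_neq2 n.
by rewrite -eq_n -modnDml -(modnDm (3 ^ a)) !modn_exp3_4 ha (negbTE hb).
Qed.
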